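(* Let $k$ be a field of characteristic $0$ and let $(E,H)$ be an extended affine Lie algebra over $k$ with core $E_c$. Then $E_c$ is stable under automorphisms of the Lie algebra $E$, i.e., $f(E_c)=E_c$ for every $f\in\operatorname{Aut}_k(E)$.
   Context: $\operatorname{Aut}_k(E)$ is the group of all $k$-linear Lie algebra automorphisms of $E$. An extended affine Lie algebra (EALA) over $k$ is a triple $(E,H,(\cdot|\cdot))$ consisting of a Lie algebra $E$ over $k$ (possibly infinite-dimensional), a subalgebra $H\subset E$ and a nondegenerate symmetric bilinear form $(\cdot|\cdot)$ on $E$ which is invariant, i.e. $([a,b]|c)=(a|[b,c])$, such that the following hold. (EA1) $H$ is a nonzero finite-dimensional toral and self-centralizing subalgebra: $E=\bigoplus_{\alpha\in H^*}E_\alpha$ with $E_\alpha=\{e\in E:[h,e]=\alpha(h)e \text{ for all } h\in H\}$, and $E_0=H$. Put $\Psi=\{\alpha\in H^*:E_\alpha\ne 0\}$ (so $0\in\Psi$). The restriction of $(\cdot|\cdot)$ to $H\times H$ is nondegenerate and is transferred to $H^*$ by $(\alpha|\beta)=(t_\alpha|t_\beta)$, where $t_\alpha\in H$ is defined by $(t_\alpha|h)=\alpha(h)$ for all $h\in H$. Put $\Psi^{\rm an}=\{\alpha\in\Psi:(\alpha|\alpha)\neq0\}$ and $\Psi^0=\{\alpha\in\Psi:(\alpha|\alpha)=0\}$. The core $E_c$ is the subalgebra of $E$ generated by $\bigcup_{\alpha\in\Psi^{\rm an}}E_\alpha$ (it is in fact an ideal of $E$). (EA2) For every $\alpha\in\Psi^{\rm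 an}$ and $x_\alpha\in E_\alpha$ the operator $\operatorname{ad}x_\alpha$ is locally nilpotent on $E$. (EA3) For any decomposition $\Psi^{\rm an}=\Psi_1\cup\Psi_2$ with $\Psi_1,\Psi_2$ nonempty one has $(\Psi_1|\Psi_2)\neq0$. (EA4) The centralizer of $E_c$ in $E$ is contained in $E_c$. (EA5) The subgroup $\Lambda=\operatorname{span}_{\mathbb Z}(\Psi^0)$ of $(H^*,+)$ is a free abelian group of finite rank. A pair $(E,H)$ is called an EALA if there is a form $(\cdot|\cdot)$ such that $(E,H,(\cdot|\cdot))$ is an EALA; the core does not depend on the choice of the form. *)

(* Defs.v *)
From HB Require Import structures.
From mathcomp Require Import all_boot all_order all_algebra.
From mathcomp Require Import sesquilinear.
From mathcomp Require Import boolp classical_sets functions.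

Set Implicit Arguments.
Unset Strict Implicit.
Unset Printing Implicit Defensive.

Import GRing.Theory.

Local Open Scope classical_set_scope.
Local Open Scope ring_scope.

HB.mixin Record Lmodule_isLie (k : fieldType) L of GRing.Lmodule k L := {
  lbr : L -> L -> L;
  lbr_linearl : forall y : L, linear (lbr^~ y);
  lbr_linearr : forall x : L, linear (lbr x);
  lbrxx : forall x : L, lbr x x = 0;
  lbr_jacobi : forall x y z : L,
    lbr x (lbr y z) + lbr y (lbr z x) + lbr z (lbr x y) = 0
}.

#[short(type="lieAlgType")]
HB.structure Definition LieAlgebra (k : fieldType) :=
  { L of Lmodule_isLie k L & GRing.Lmodule k L }.

Section LieAlgebra.
Context (k : fieldType) (L : lieAlgType k).

Definition lie_subalgebra (S : set L) : Prop :=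
  [/\ S 0,
      forall (a : k) (x y : L), S x -> S y -> S (a *: x + y)
    & forall x y : L, S x -> S y -> S (lbr x y)].

Definition lie_generated (A : set L) : set L := smallest lie_subalgebra A.

Definition lie_centralizer (A : set L) : set L :=
  [set x | forall a, A a -> lbr x a = 0].

Definition ad_locally_nilpotent (x : L) : Prop :=
  forall y : L, exists n : nat, iter n (lbr x) y = 0.

Definition lie_automorphism (f : {linear L -> L}) : Prop :=
  bijective f /\ forall x y : L, f (lbr x y) = lbr (f x) (f y).

(* L is the internal direct sum of the subspaces V i, for i in D *)
Definition is_direct_sum (I : Type) (D : set I) (V : I -> set L) : Prop :=
  (forall e : L, exists n (a : 'I_n -> I) (x : 'I_n -> L),
     (forall i, D (a i) /\ V (a i) (x i)) /\ e = \sum_i x i) /\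
  (forall n (a : 'I_n -> I) (x : 'I_n -> L),
     injective a -> (forall i, D (a i) /\ V (a i) (x i)) ->
     \sum_i x i = 0 -> forall i, x i = 0).

End LieAlgebra.

Definition int_span (V : zmodType) (A : set V) : set V :=
  [set v | exists n (a : 'I_n -> V) (z : 'I_n -> int),
     (forall i, A (a i)) /\ v = \sum_i a i *~ z i].

Definition free_of_finite_rank (V : zmodType) (G : set V) : Prop :=
  exists n (b : 'I_n -> V),
    G = int_span (range b) /\
    (forall z : 'I_n -> int, \sum_i b i *~ z i = 0 -> forall i, z i = 0).

(* Being closed under the bracket is not part of the type of H below; it is
   required by EA_subalg. *)
Section EALA.
Context (k : fieldType) (E : lieAlgType k) (H : submodClosed E).

Definition subT : Type := {h : E | h \in H}.
HB.instance Definition _ := SubChoice.on subT.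
HB.instance Definition _ := [SubChoice_isSubLmodule of subT by <:].

(* H^* is the set of linear functions inside the group of all functions
   H -> k, so that equality of weights is Leibniz equality. *)
Definition dual : set (subT -> k) := [set alpha | scalar alpha].

Definition weight_space (alpha : subT -> k) : set E :=
  [set e | forall h : subT, lbr (val h) e = alpha h *: e].

Definition Psi : set (subT -> k) :=
  [set alpha | dual alpha /\ exists2 e, weight_space alpha e & e != 0].

Definition finite_dim_sub : Prop :=
  exists n (b : 'I_n -> subT), forall h : subT,
    exists c : 'I_n -> k, h = \sum_i c i *: b i.

Variable form : {biscalar E}.

Definition nondegenerate_form : Prop :=
  forall x : E, (forall y : E, form x y = 0) -> x = 0.

Definition invariant_form : Prop :=
  forall a b c : E, form (lbr a b) c = form a (lbr b c).

(* The element of H representing alpha through the form. It exists and is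
   unique for alpha in H^*, since the form is nondegenerate on H for an EALA;
   otherwise an arbitrary solution, or 0 by default. *)
Definition t_ (alpha : subT -> k) : subT :=
  xget 0 [set t : subT | forall h : subT, form (val t) (val h) = alpha h].

Definition dual_form (alpha beta : subT -> k) : k :=
  form (val (t_ alpha)) (val (t_ beta)).

Definition Psi_an : set (subT -> k) :=
  [set alpha | Psi alpha /\ dual_form alpha alpha != 0].

Definition Psi_0 : set (subT -> k) :=
  [set alpha | Psi alpha /\ dual_form alpha alpha = 0].

Definition core : set E :=
  lie_generated (\bigcup_(alpha in Psi_an) weight_space alpha).

Record is_EALA : Prop := IsEALA {
  EA_sym : forall x y : E, form x y = form y x;
  EA_nondeg : nondegenerate_form;
  EA_inv : invariant_form;
  EA_subalg : lie_subalgebra [set` H];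
  EA1_neq0 : exists2 h : E, h \in H & h != 0;
  EA1_findim : finite_dim_sub;
  EA1_toral : is_direct_sum dual weight_space;
  EA1_selfcentral : weight_space 0 = [set` H];
  EA2 : forall alpha x, Psi_an alpha -> weight_space alpha x ->
    ad_locally_nilpotent x;
  EA3 : forall Psi1 Psi2 : set (subT -> k), Psi1 !=set0 -> Psi2 !=set0 ->
    Psi_an = Psi1 `|` Psi2 ->
    exists alpha beta, [/\ Psi1 alpha, Psi2 beta & dual_form alpha beta != 0];
  EA4 : lie_centralizer core `<=` core;
  EA5 : free_of_finite_rank (int_span Psi_0)
}.

End EALA.

(* Main.v *)
From HB Require Import structures.
Require Import Defs.
From mathcomp Require Import all_boot all_order all_algebra.
From mathcomp Require Import sesquilinear.
From mathcomp Require Import boolp classical_sets functions.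
From mathcomp Require Import ring zify.

(** The core is singled out among the ideals of E without reference to H or to
    the form: it is the smallest nonabelian ideal.  Granted this, an
    automorphism f permutes the nonabelian ideals, so the core lies in its own
    image and in its own preimage under f, and hence equals its image.

    That the core is an ideal ([core_ideal]) rests on the orthogonality of
    isotropic and anisotropic roots ([isotropic_orthogonal]).  Suppose de is
    isotropic, al anisotropic and (al|de) nonzero.  Vectors of weights de and
    -de span a Heisenberg algebra whose center acts on the string of
    weights al + m de by a nonzero scalar; in characteristic 0 such a
    representation is infinite-dimensional, so the string is infinite on one
    side, and al + 3 de is a root after replacing de by -de if necessary.  By
    (EA2) and the representation theory of sl2, the numbers
    2(ga|be)/(ga|ga) are integers for ga anisotropic ([root_integral]), and
    this fails for ga = al + 3 de and be = al.

    Let now I be an ideal.  It is the sum of its intersections with the weight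
    spaces ([graded_ideal_sub]).  If I contains a nonzero x of anisotropic
    root al, bracketing x with a vector of root -al shows that I contains the
    element t_al of H, hence all root spaces of roots not orthogonal to al;
    by the connectedness axiom (EA3) I contains the core
    ([ideal_contains_core]).  Otherwise only isotropic weights occur in I, and
    I centralizes the core ([ideal_centralizes_core]); by (EA4) it then lies
    in the core and is abelian.  So every nonabelian ideal contains the
    core, and the core is itself nonabelian as it contains the sl2-triples of
    the anisotropic roots. *)

Set Implicit Arguments.
Unset Strict Implicit.
Unset Printing Implicit Defensive.

Import GRing.Theory.

Local Open Scope classical_set_scope.
Local Open Scope ring_scope.

(** * Lie algebras *)

Section LieAlgebraTheory.
Context (k : fieldType) (L : lieAlgType k).

HB.instance Definition _ :=
  bilinear_isBilinear.Build k L L L *:%R *:%R (@lbr k L)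
    (@lbr_linearl k L, @lbr_linearr k L).

Implicit Types x y z : L.

Lemma lbrC x y : lbr x y = - lbr y x.
Proof.
apply/eqP; rewrite -addr_eq0; apply/eqP.
by have := lbrxx (x + y); rewrite linearDl /= !linearDr /= !lbrxx add0r addr0.
Qed.

Lemma lbr_leibniz x y z : lbr x (lbr y z) = lbr (lbr x y) z + lbr y (lbr x z).
Proof.
have /eqP := lbr_jacobi x y z.
rewrite (lbrC z (lbr x y)) (lbrC z x) linearNr /= subr_eq0 => /eqP <-.
by rewrite addrNK.
Qed.

Definition lie_ideal (I : set L) : Prop :=
  [/\ I 0,
      forall (a : k) x y, I x -> I y -> I (a *: x + y)
    & forall e x, I x -> I (lbr e x)].

Lemma subalgebra_sum (S : set L) (J : Type) (r : seq J) (P : pred J)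
    (F : J -> L) :
  lie_subalgebra S -> (forall i, P i -> S (F i)) -> S (\sum_(i <- r | P i) F i).
Proof.
move=> [S0 SD _] SF; elim/big_ind: _ => // x y Sx Sy.
by rewrite -[x]scale1r; apply: SD.
Qed.

Lemma ideal_subalgebra (I : set L) : lie_ideal I -> lie_subalgebra I.
Proof. by case=> I0 ID IB; split=> // x y _; apply: IB. Qed.

Lemma subalgebraZ (S : set L) a x : lie_subalgebra S -> S x -> S (a *: x).
Proof. by move=> [S0 SD _] Sx; rewrite -[_ *: x]addr0; apply: SD. Qed.

Lemma ideal_lbrl (I : set L) x e : lie_ideal I -> I x -> I (lbr x e).
Proof.
move=> idI Ix; rewrite lbrC -scaleN1r; apply: subalgebraZ.
  exact: ideal_subalgebra.
by case: idI => _ _; apply.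
Qed.

Lemma lie_generated_subalgebra (A : set L) : lie_subalgebra (lie_generated A).
Proof.
split=> [S [[S0 _ _] _] //|a x y gx gy S SA|x y gx gy S SA];
  have [[_ SD SB] _] := SA; [apply: SD|apply: SB]; by [apply: gx|apply: gy].
Qed.

Lemma centralizer_generated (A : set L) x :
  lie_centralizer A x -> lie_centralizer (lie_generated A) x.
Proof.
move=> cAx a; apply: (smallest_sub (X := [set a | lbr x a = 0])) => //.
split=> [|b u v /= xu xv|u v /= xu xv].
- exact: linear0r.
- by rewrite linearPr /= xu xv scaler0 addr0.
- by rewrite lbr_leibniz xu xv linear0l /= linear0r /= addr0.
Qed.

(** Brackets with a fixed element are derivations, so the elements of a
    subalgebra that all of the Lie algebra multiplies into it form a
    subalgebra; it suffices to look at generators. *)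
Lemma generated_ideal (A : set L) :
  (forall e a, A a -> lie_generated A (lbr e a)) ->
  lie_ideal (lie_generated A).
Proof.
move=> AI; have sG := lie_generated_subalgebra A.
have [G0 GD GB] := sG; split=> // e x Gx.
pose X := [set x | lie_generated A x /\ forall e, lie_generated A (lbr e x)].
suff /(_ x Gx)[] : lie_generated A `<=` X by [].
apply: smallest_sub => [|a Aa]; last first.
  by split; [apply: sub_gen_smallest|move=> ?; exact: AI].
split=> [|a u v [Gu Iu] [Gv Iv]|u v [Gu Iu] [Gv Iv]].
- by split=> // d; rewrite linear0r /=.
- by split=> [|d]; [apply: GD|rewrite linearPr /=; apply: GD].
- split=> [|d]; first exact: GB.
  by rewrite lbr_leibniz -[lbr (lbr d u) v]scale1r; apply: (GD); apply: GB.
Qed.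

(** * Strings through a highest weight vector *)

(** The operator ad [x, y] has eigenvalue d - 2 c i on the vector number i of
    the string through w, and the coefficient is the sum of the first m + 1 of
    these eigenvalues.  The case of nonzero c is that of sl2, the case c = 0
    that of a Heisenberg algebra. *)
Lemma raise_lowered (x y w : L) (c d : k) (m : nat) :
  lbr x w = 0 -> lbr (lbr x y) w = d *: w ->
  lbr (lbr x y) y = - (c *+ 2) *: y ->
  lbr x (iter m.+1 (lbr y) w) =
    (m.+1%:R * (d - c * m%:R)) *: iter m (lbr y) w.
Proof.
move=> xw tw ty.
have tm n : lbr (lbr x y) (iter n (lbr y) w)
            = (d - c *+ 2 * n%:R) *: iter n (lbr y) w.
  elim: n => [|n IHn]; first by rewrite /= mulr0 subr0.
  rewrite iterS lbr_leibniz ty IHn linearZl_LR /= linearZr_LR /= -scalerDl.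
  by congr (_ *: _); ring.
elim: m => [|m IHm].
  by rewrite /= lbr_leibniz xw linear0r /= addr0 tw mul1r mulr0 subr0.
rewrite iterS lbr_leibniz IHm tm linearZr_LR /= -scalerDl.
by congr (_ *: _); ring.
Qed.

(** In characteristic 0 the coefficient above vanishes only if d = c m. *)
Lemma lowered_neq0 (x y w : L) (c d : k) : [pchar k] =i pred0 ->
  lbr x w = 0 -> lbr (lbr x y) w = d *: w ->
  lbr (lbr x y) y = - (c *+ 2) *: y ->
  w != 0 -> (forall m : nat, d != c * m%:R) ->
  forall m, iter m (lbr y) w != 0.
Proof.
move=> /pcharf0P k0 xw tw ty w0 dc; elim=> // m IHm.
apply/eqP => ym0; have := raise_lowered m xw tw ty.
rewrite ym0 linear0r /= => /esym/eqP; rewrite scaler_eq0 (negPf IHm) orbF.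
by rewrite mulf_eq0 k0 /= subr_eq0 (negPf (dc m)).
Qed.

Lemma raised_last (x v : L) : v != 0 ->
  (forall m, iter m (lbr x) v != 0) \/
  exists2 N, iter N (lbr x) v != 0 & lbr x (iter N (lbr x) v) = 0.
Proof.
move=> v0.
have [xv|] := pselect (forall m, iter m (lbr x) v != 0); first by left.
move=> /existsNP[n /negP/negPn xn]; right.
have /ex_minnP[[|N] xN minN] : exists n, iter n (lbr x) v == 0 by exists n.
  by rewrite /= (negPf v0) in xN.
exists N; last exact/eqP.
by apply/negP => /minN; rewrite ltnn.
Qed.

End LieAlgebraTheory.

(** * Weight spaces and graded ideals *)

Section Weights.
Context (k : fieldType) (E : lieAlgType k) (H : submodClosed E).
Implicit Types (al be ga de : subT H -> k) (x y v : E) (h t : subT H).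

Lemma weight_bracket al be x y : weight_space al x -> weight_space be y ->
  weight_space (al + be) (lbr x y).
Proof.
move=> xal ybe h.
by rewrite lbr_leibniz xal ybe linearZl_LR /= linearZr_LR /= -scalerDl.
Qed.

Lemma weight_iter al be x v m : weight_space al x -> weight_space be v ->
  weight_space (be + al *+ m) (iter m (lbr x) v).
Proof.
move=> xal vbe; elim: m => [|m IHm]; first by rewrite mulr0n addr0.
by rewrite mulrS addrCA; apply: weight_bracket.
Qed.

Lemma weightZ al (a : k) x : weight_space al x -> weight_space al (a *: x).
Proof. by move=> xal h; rewrite linearZr_LR /= xal /= !scalerA mulrC. Qed.

Lemma dualD al be : dual al -> dual be -> dual (al + be).
Proof.
move=> dal dbe a h h'.
by rewrite !fctE dal dbe /= mulrDr addrACA.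
Qed.

Lemma dualN al : dual al -> dual (- al).
Proof. by move=> dal a h h'; rewrite !fctE dal /= opprD mulrN. Qed.

Lemma dualMn al m : dual al -> dual (al *+ m).
Proof.
move=> dal; elim: m => [|m IHm]; last by rewrite mulrS; exact: dualD.
by move=> a h h'; rewrite mulr0n /= mulr0 addr0.
Qed.

(** If h separates al from another weight be of the sum, the operator
    (ad h - be h) / (al h - be h) preserves I, kills the component of weight be
    and fixes that of weight al. *)
Lemma ideal_component (I : set E) n (a : 'I_n -> subT H -> k)
    (x : 'I_n -> E) al : lie_ideal I ->
  (forall i, weight_space (a i) (x i)) -> I (\sum_i x i) ->
  I (\sum_(i | a i == al) x i).
Proof.
move=> idI xa Ix; have [I0 ID IB] := idI.
(* c be is the scalar by which the product of these operators acts on E_be. *)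
suff [c [cal cx Ic]] : exists c : (subT H -> k) -> k,
    [/\ c al = 1,
        forall be, be \in [seq a i | i <- enum 'I_n & a i != al] -> c be = 0
      & I (\sum_i c (a i) *: x i)].
  rewrite (bigID (fun i => a i == al)) /= [X in _ + X]big1 ?addr0 in Ic.
    by rewrite (eq_bigr x) in Ic => // i /eqP->; rewrite cal scale1r.
  move=> i ai; rewrite cx ?scale0r //; apply: map_f.
    by rewrite mem_filter ai mem_enum.
have : all (fun be => be != al) [seq a i | i <- enum 'I_n & a i != al].
  by apply/allP => be /mapP[i]; rewrite mem_filter => /andP[ai _] ->.
elim: [seq a i | i <- enum 'I_n & a i != al] => [|be s IHs /andP[beal sal]].
  by move=> _; exists (fun=> 1); split=> //; under eq_bigr do rewrite scale1r.
have [h hbe] : exists h, be h != al h.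
  apply: contrapT => /forallNP beh; move: beal.
  apply/negP/negPn/eqP/funext => h.
  by apply/eqP/negPn/negP/beh.
have [c [cal cs Ic]] := IHs sal.
have alh : al h - be h != 0 by rewrite subr_eq0 eq_sym.
exists (fun ga => (ga h - be h) / (al h - be h) * c ga); split.
- by rewrite cal mulr1 divff.
- move=> ga; rewrite inE => /predU1P[->|/cs->]; last by rewrite mulr0.
  by rewrite subrr !mul0r.
suff -> : \sum_i ((a i h - be h) / (al h - be h) * c (a i)) *: x i =
    (al h - be h)^-1 *: (- be h *: (\sum_i c (a i) *: x i)
                          + lbr (val h) (\sum_i c (a i) *: x i)).
  apply: subalgebraZ; first exact: ideal_subalgebra.
  by apply: ID => //; apply: IB.
rewrite linear_sumr /= !scaler_sumr -big_split scaler_sumr.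
apply: eq_bigr => i _ /=.
rewrite linearZr_LR /= xa /= !scalerA -scalerDl scalerA; congr (_ *: _).
by rewrite -mulrA mulrCA; congr (_ * _); ring.
Qed.

(** Weights may repeat in a decomposition, so its terms are regrouped along the
    map sending an index to a chosen index of the same weight. *)
Lemma graded_ideal_sub (I S : set E) :
  is_direct_sum (@dual k E H) (@weight_space k E H) ->
  lie_ideal I -> lie_subalgebra S ->
  (forall al x, dual al -> weight_space al x -> I x -> S x) -> I `<=` S.
Proof.
move=> [dec _] idI sS IS x; have [n [a [y [ya ->]]]] := dec x => Ix.
pose p i := odflt i [pick j | a j == a i].
have ap i : a (p i) = a i.
  by rewrite /p; case: pickP => [j /eqP//|/(_ i)]; rewrite eqxx.
have pE i j : a i = a j -> p i = p j.
  move=> aij; rewrite /p aij; case: pickP => // /(_ j); by rewrite eqxx.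
rewrite (partition_big p predT) //=; apply: subalgebra_sum => // j _.
have [/existsP[i0 /eqP pi0]|/existsPn pj] := boolP [exists i, p i == j];
  last first.
  by rewrite big_pred0; [case: sS|move=> i /=; rewrite (negPf (pj i))].
rewrite (eq_bigl (fun i => a i == a i0)); last first.
  move=> i; apply/eqP/eqP => [pij|/pE->//].
  by rewrite -(ap i) pij -pi0 ap.
apply: (IS (a i0)).
- by case: (ya i0).
- move=> h; rewrite linear_sumr /= scaler_sumr; apply: eq_bigr => i /eqP <-.
  by case: (ya i) => _ ->.
- by apply: ideal_component => // i; case: (ya i).
Qed.

End Weights.

Section EALATheory.
Context (k : fieldType) (k0 : [pchar k] =i pred0).
Context (E : lieAlgType k) (H : submodClosed E) (form : {biscalar E}).
Context (hE : is_EALA H form).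
Implicit Types (al be ga de : subT H -> k) (x y e v : E) (h t : subT H).

Local Notation Psi := (@Psi k E H).
Local Notation Psi_an := (@Psi_an k E H form).
Local Notation dform := (dual_form form).
Local Notation core := (core H form).

Lemma natr_neq0 n : n.+1%:R != 0 :> k.
Proof. by have /pcharf0P -> := k0. Qed.

Lemma intr_inj0 (m n : int) : m%:~R = n%:~R :> k -> m = n.
Proof.
move=> /eqP; rewrite -subr_eq0 -intrB => mn0; apply/eqP; rewrite -subr_eq0.
have /pcharf0P kn := k0; move: mn0; case: (m - n) => p; first by rewrite kn.
by rewrite NegzE mulrNz oppr_eq0 kn.
Qed.

(** * The form on roots *)

Lemma weight0_val e :
  weight_space (0 : subT H -> k) e -> exists t : subT H, val t = e.
Proof. by rewrite (EA1_selfcentral hE) => He; exists (exist _ e He). Qed.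

(** By invariance x is orthogonal to all weight spaces except that of -al, so
    nondegeneracy of the form provides y in the latter with (x|y) = 1; then
    ([x, y]|h) = (x|[y, h]) = al h. *)
Lemma opposite_vector al x : Psi al -> weight_space al x -> x != 0 ->
  exists y t, [/\ weight_space (- al) y, y != 0, lbr x y = val t
                & forall h, form (val t) (val h) = al h].
Proof.
move=> [dal _] xal x0.
have [z xz] : exists z, form x z != 0.
  apply: contrapT => /forallNP xz; move: x0; apply/negP/negPn/eqP.
  by apply: (EA_nondeg hE) => z; apply/eqP/negPn/negP/xz.
have [dec _] := EA1_toral hE; have [n [a [u [ua zE]]]] := dec z.
have [i xui] : exists i, form x (u i) != 0.
  apply: contrapT => /forallNP xu; move: xz; rewrite zE linear_sumr.
  by rewrite big1 ?eqxx //= => i _; apply/eqP/negPn/negP/xu.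
have ai : a i = - al.
  apply/funext => h; apply: (mulIf xui); rewrite fctE.
  have := EA_inv hE x (val h) (u i).
  have [_ ->] := ua i.
  by rewrite lbrC xal linearNl /= linearZl_LR /= linearZr_LR /= mulNr => ->.
pose y := (form x (u i))^-1 *: u i.
have yal : weight_space (- al) y by apply: weightZ; rewrite -ai; case: (ua i).
have xy : form x y = 1 by rewrite linearZr_LR /= mulVf.
have [|t tE] := @weight0_val (lbr x y).
  by rewrite -(subrr al); apply: weight_bracket.
exists y, t; split=> // [|h].
  by apply: contraTneq (oner_neq0 k) => y0; rewrite -xy y0 linear0r eqxx.
rewrite tE (EA_inv hE) lbrC yal fctE scaleNr opprK linearZr_LR /= xy.
exact: mulr1.
Qed.

Lemma PsiN al : Psi al -> Psi (- al).
Proof.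
move=> Pal; have [dal [x xal x0]] := Pal.
have [y [_ [yal y0 _ _]]] := opposite_vector Pal xal x0.
by split; [apply: dualN|exists y].
Qed.

Lemma t_E al h : Psi al -> form (val (t_ form al)) (val h) = al h.
Proof.
move=> Pal; have [_ [x xal x0]] := Pal.
have [_ [t [_ _ _ tal]]] := opposite_vector Pal xal x0.
by have := @xgetPex _ 0 _ (ex_intro _ t tal : exists t, [set t | _] t); exact.
Qed.

Lemma dformE al be : Psi al -> dform al be = al (t_ form be).
Proof. by move=> Pal; rewrite /dual_form t_E. Qed.

Lemma dformC al be : dform al be = dform be al.
Proof. exact: (EA_sym hE). Qed.

(** The element t = [x, y] is central on the span of x, y, t if al is
    isotropic, and x, y, t is an sl2-triple up to scaling otherwise. *)
Lemma coroot al x : Psi al -> weight_space al x -> x != 0 ->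
  exists y t, [/\ weight_space (- al) y, y != 0, lbr x y = val t
                & forall be, Psi be -> be t = dform al be].
Proof.
move=> Pal xal x0; have [y [t [yal y0 xy tal]]] := opposite_vector Pal xal x0.
exists y, t; split=> // be Pbe.
by rewrite -(t_E t Pbe) (EA_sym hE) tal dformE.
Qed.

Lemma dformDl al be ga : Psi al -> Psi be -> Psi (al + be) ->
  dform (al + be) ga = dform al ga + dform be ga.
Proof. by move=> Pal Pbe Pab; rewrite !dformE. Qed.

Lemma dformDMnl al be ga n : Psi al -> Psi be -> Psi (al + be *+ n) ->
  dform (al + be *+ n) ga = dform al ga + dform be ga *+ n.
Proof. by move=> Pal Pbe Pab; rewrite !dformE // natmulfctE. Qed.

Lemma dformNl al ga : Psi al -> dform (- al) ga = - dform al ga.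
Proof. by move=> Pal; rewrite !dformE //; apply: PsiN. Qed.

Lemma Psi_anN al : Psi_an al -> Psi_an (- al).
Proof.
move=> [Pal alal]; split; first exact: PsiN.
by rewrite dformNl // dformC dformNl // opprK.
Qed.

Lemma weight_Psi al x : dual al -> weight_space al x -> x != 0 -> Psi al.
Proof. by move=> dal xal x0; split=> //; exists x. Qed.

(** * Integrality, and orthogonality of isotropic and anisotropic roots *)

(** Raise a vector of weight be by E_al until a highest weight vector is
    reached, then lower it by E_(-al) until it vanishes: the lengths of the
    two strings give the integer: (al|be) + N (al|al) = M (al|al)/2 if they
    have lengths N and M. *)
Lemma root_integral al be : Psi_an al -> Psi be ->
  exists n : int, dform al be *+ 2 = dform al al * n%:~R.
Proof.
move=> Aal Pbe; have [Pal al0] := Aal.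
have [_ [x xal x0]] := Pal; have [dbe [v vbe v0]] := Pbe.
have [y [t [yal y0 xy tE]]] := coroot Pal xal x0.
have [|[N w0 xw]] := raised_last x v0.
  have [n xn] := EA2 hE Aal xal v.
  by move=> /(_ n); rewrite xn eqxx.
set w := iter N (lbr x) v in w0 xw.
have [m ym] := EA2 hE (Psi_anN Aal) yal w.
pose c := dform al al / 2.
have c2 : c *+ 2 = dform al al by rewrite -mulr_natr divfK ?natr_neq0.
have tw : lbr (lbr x y) w = (dform al be + dform al al *+ N) *: w.
  rewrite xy (weight_iter N xal vbe) fctE natmulfctE.
  by rewrite !tE.
have ty : lbr (lbr x y) y = - (c *+ 2) *: y by rewrite xy yal c2 fctE tE.
have [M dM] : exists M : nat, dform al be + dform al al *+ N = c * M%:R.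
  apply: contrapT => /forallNP nM.
  have := lowered_neq0 k0 xw tw ty w0 _ m; rewrite ym eqxx => /(_ _)/notF.
  by apply=> M; apply/eqP/nM.
exists (M%:Z - (N * 2)%N%:Z).
rewrite intrB mulrBr -!pmulrn -{1}c2 mulrnAl -dM natrM.
by rewrite -mulr_natr; ring.
Qed.

(** For isotropic de the pair E_de, E_(-de) spans a Heisenberg algebra whose
    center acts on the string of weights be + m de by the nonzero scalar
    (be|de), so raising and lowering cannot both terminate. *)
Lemma isotropic_string de be : Psi de -> dform de de = 0 -> Psi be ->
  dform de be != 0 ->
  (forall m, Psi (be + de *+ m)) \/ (forall m, Psi (be + (- de) *+ m)).
Proof.
move=> Pde de0 Pbe debe.
have [dde [x xde x0]] := Pde; have [dbe [v vbe v0]] := Pbe.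
have [y [t [yde y0 xy tE]]] := coroot Pde xde x0.
have [xv|[N w0 xw]] := raised_last x v0; [left|right] => m.
  apply: (weight_Psi _ (weight_iter m xde vbe) (xv m)).
  by apply: dualD => //; apply: dualMn.
set w := iter N (lbr x) v in w0 xw.
have wde := weight_iter N xde vbe.
have tw : lbr (lbr x y) w = dform de be *: w.
  by rewrite xy wde fctE natmulfctE !tE // de0 mul0rn addr0.
have ty : lbr (lbr x y) y = - (0 *+ 2) *: y.
  by rewrite xy yde fctE tE // de0 mul0rn.
have yw : iter (N + m) (lbr y) w != 0.
  by apply: (lowered_neq0 k0 xw tw ty w0) => M; rewrite mul0r.
apply: (weight_Psi _ _ yw); first by apply: dualD => //; apply/dualMn/dualN.
suff -> : be + (- de) *+ m = be + de *+ N + (- de) *+ (N + m).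
  exact: weight_iter.
by rewrite mulrnDr addrA !mulNrn addrK.
Qed.

(** With 2(al|de) = n (al|al), the root ga = al + 3 de has
    (ga|ga) = (1 + 3 n)(al|al), and integrality for ga and al makes
    1 + 3 n divide 2 + 3 n, hence 1; so n = 0.  The multiple 3 is the first one
    that works: 1 + n and 1 + 2 n may be 0 or -1 for nonzero n. *)
Lemma no_third_translate al de : Psi_an al -> Psi de -> dform de de = 0 ->
  dform al de != 0 -> ~ Psi (al + de *+ 3).
Proof.
move=> Aal Pde de0 alde Pga; have [Pal al0] := Aal.
have [n nE] := root_integral Aal Pde.
have n0 : n != 0.
  apply: contra_neq alde => n0; apply/eqP; move/eqP: nE.
  by rewrite n0 mulr0 -mulr_natr mulf_eq0 (negPf (natr_neq0 1)) orbF.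
have gaal : dform (al + de *+ 3) al = dform al al + dform al de *+ 3.
  by rewrite dformDMnl // (dformC de).
have gaga : dform (al + de *+ 3) (al + de *+ 3) = dform al al * (1 + 3 * n)%:~R.
  rewrite {1}dformDMnl // !(dformC _ (al + _)) gaal.
  rewrite dformDMnl // de0 mul0rn addr0.
  by rewrite intrD intrM mulrDr mulr1 mulrCA -nE; ring.
have n3 : 1 + 3 * n != 0 by apply/eqP; lia.
have Aga : Psi_an (al + de *+ 3).
  split=> //; rewrite gaga mulf_neq0 //.
  by apply: contra_neq n3 => /(@intr_inj0 _ 0).
have [p pE] := root_integral Aga Pal.
have : (2 + 3 * n)%:~R = ((1 + 3 * n) * p)%:~R :> k.
  apply: (mulfI al0); rewrite [in RHS]intrM mulrA -gaga -pE gaal.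
  by rewrite intrD intrM mulrDr [X in _ + X]mulrCA -nE; ring.
move/intr_inj0 => np; have {}np : (p - 1) * (1 + 3 * n) = 1 by lia.
have [p1|[p1|p1]] : p - 1 >= 1 \/ (p - 1 = 0 \/ p - 1 <= -1) by lia.
- by have [] : n >= 1 \/ n <= -1; [lia|nia|nia].
- by rewrite p1 mul0r in np.
- by have [] : n >= 1 \/ n <= -1; [lia|nia|nia].
Qed.

Lemma isotropic_orthogonal al de : Psi_an al -> Psi de -> dform de de = 0 ->
  dform al de = 0.
Proof.
move=> Aal Pde de0; apply/eqP/negPn/negP => alde.
have Nde0 : dform (- de) (- de) = 0.
  by rewrite dformNl // dformC dformNl // de0 !oppr0.
have [] := @isotropic_string de al Pde de0; first by case: Aal.
- by rewrite dformC.
- by move/(_ 3); apply: no_third_translate.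
- move/(_ 3); apply: no_third_translate => //; first exact: PsiN.
  by rewrite dformC dformNl // oppr_eq0 dformC.
Qed.

(** * The core *)

Lemma root_in_core al x : Psi_an al -> weight_space al x -> core x.
Proof. by move=> Aal xal; apply: sub_gen_smallest; exists al. Qed.

Lemma Psi_an_shift al de : Psi_an al -> Psi de -> dform de de = 0 ->
  dform al de = 0 -> Psi (de + al) -> Psi_an (de + al).
Proof.
move=> [Pal al0] Pde de0 alde Pga; split=> //.
rewrite dformDl // !(dformC _ (de + al)) !dformDl // de0 alde.
by rewrite (dformC de) alde !add0r.
Qed.

(** For de isotropic and al anisotropic, orthogonality gives
    (de + al|de + al) = (al|al), so the bracket of E_de and E_al lies in the
    space of an anisotropic root or vanishes. *)
Lemma core_ideal : lie_ideal core.
Proof.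
apply: generated_ideal => e x [al Aal xal].
have [dec _] := EA1_toral hE; have [n [a [u [ua ->]]]] := dec e.
rewrite linear_sumlz /=; apply: subalgebra_sum => [|i _].
  exact: lie_generated_subalgebra.
have sC := lie_generated_subalgebra (\bigcup_(al in Psi_an) weight_space al).
have [C0 _ CB] := sC.
have [dai uai] := ua i.
have [->|ui0] := eqVneq (u i) 0; first by rewrite linear0l.
have Pai := weight_Psi dai uai ui0.
have [ai0|ai0] := eqVneq (dform (a i) (a i)) 0; last first.
  by apply: CB; [apply: root_in_core uai|apply: root_in_core xal].
have uxw := weight_bracket uai xal.
have [->//|ux0] := eqVneq (lbr (u i) x) 0.
apply: (root_in_core _ uxw); apply: Psi_an_shift => //.
  exact: isotropic_orthogonal.
by apply: weight_Psi uxw ux0; apply: dualD => //; case: Aal => -[].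
Qed.

(** Without anisotropic roots the core is 0, its centralizer is E, and (EA4)
    forces E = 0. *)
Lemma Psi_an_neq0 : Psi_an !=set0.
Proof.
apply/set0P/eqP => an0; have [h _] := EA1_neq0 hE; apply/negP/negPn/eqP.
suff : core h.
  apply: (smallest_sub (X := [set 0])); last by rewrite an0 bigcup_set0.
  split=> // [a x y -> ->|x y -> ->]; first by rewrite scaler0 addr0.
  by rewrite /= lbrxx.
apply: (EA4 hE); apply: centralizer_generated.
by rewrite an0 bigcup_set0.
Qed.

Lemma core_nonabelian : exists x y, [/\ core x, core y & lbr x y != 0].
Proof.
have [al Aal] := Psi_an_neq0; have [Pal al0] := Aal.
have [_ [x xal x0]] := Pal; have [y [t [yal y0 xy tE]]] := coroot Pal xal x0.
have xC := root_in_core Aal xal; have yC := root_in_core (Psi_anN Aal) yal.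
exists (lbr x y), x; split=> //; first by case: core_ideal => _ _; apply.
by rewrite xy xal tE // scaler_eq0 negb_or al0.
Qed.

(** * Ideals and the core *)

Section Ideal.
Context (I : set E) (idI : lie_ideal I).

(** A nonzero vector of I of root de yields t_de in I, and t_de acts on E_al
    by the scalar (de|al). *)
Lemma ideal_contains_root_space de al z : Psi de -> Psi al ->
  dform de al != 0 -> weight_space de z -> I z -> z != 0 ->
  weight_space al `<=` I.
Proof.
move=> Pde Pal deal zde Iz z0 x xal.
have [y [t [_ _ zy tE]]] := coroot Pde zde z0.
suff Itx : I (dform de al *: x).
  rewrite -[x]scale1r -(mulVf deal) -scalerA; apply: subalgebraZ => //.
  exact: ideal_subalgebra.
by rewrite -tE // -xal -zy; do 2 apply: ideal_lbrl => //.
Qed.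

(** By (EA3), meeting one anisotropic root space propagates to all. *)
Lemma ideal_contains_core al x : Psi_an al -> weight_space al x -> I x ->
  x != 0 -> core `<=` I.
Proof.
move=> Aal xal Ix x0.
suff anI be : Psi_an be -> weight_space be `<=` I.
  by apply: smallest_sub; [exact: ideal_subalgebra|move=> y [be /anI]; apply].
move=> Abe; apply: contrapT => beI.
pose P1 := [set ga | Psi_an ga /\ weight_space ga `<=` I].
pose P2 := [set ga | Psi_an ga /\ ~ weight_space ga `<=` I].
have [| | |ga [de [[[Pga _] gaI] [[Pde _] deI] gade]]] :=
  EA3 hE (Psi1 := P1) (Psi2 := P2).
- exists al; split=> //; have [Pal al0] := Aal.
  exact: ideal_contains_root_space xal Ix x0.
- by exists be.
- apply/seteqP; split=> [ga Aga|ga [] []//].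
  by have [|] := pselect (weight_space ga `<=` I); [left|right].
have [_ [z zga z0]] := Pga.
by apply: deI; apply: ideal_contains_root_space zga (gaI _ zga) z0.
Qed.

(** If I meets no anisotropic root space, then its homogeneous elements have
    isotropic roots, and each such x, of root de, kills E_al:
    otherwise either (de|al) is nonzero and E_al lies in I, or de + al is an
    anisotropic root whose root space meets I. *)
Lemma ideal_centralizes_core : ~ core `<=` I -> I `<=` lie_centralizer core.
Proof.
move=> nCI x Ix; apply: centralizer_generated; move: x Ix.
have anI al x : Psi_an al -> weight_space al x -> I x -> x = 0.
  move=> Aal xal Ix; apply/eqP/negPn/negP => x0.
  exact/nCI/(ideal_contains_core Aal xal Ix x0).
have [I0 ID IB] := idI.
pose S := lie_centralizer (\bigcup_(al in Psi_an) weight_space al).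
suff : I `<=` S by [].
apply: graded_ideal_sub idI _ _; first exact: (EA1_toral hE).
  split=> [e _|a x y Sx Sy e Ae|x y Sx Sy e Ae]; first exact: linear0l.
    by rewrite linearPl /= Sx // Sy // scaler0 addr0.
  rewrite lbrC lbr_leibniz (lbrC e) Sx // (lbrC e) Sy // oppr0.
  by rewrite linear0l /= linear0r /= addr0 oppr0.
move=> de x dde xde Ix e [al Aal eal].
have [Pal al0] := Aal.
have [->|x0] := eqVneq x 0; first exact: linear0l.
have Pde := weight_Psi dde xde x0.
have de0 : dform de de = 0.
  by apply/eqP/negPn/negP => de0; rewrite (anI de x) ?eqxx in x0.
have [deal|deal] := eqVneq (dform de al) 0; last first.
  rewrite (anI al e) //; first exact: linear0r.
  exact: ideal_contains_root_space xde Ix x0 _ eal.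
have xew := weight_bracket xde eal.
apply: contrapT => /eqP xe0; move: (xe0); apply/negP/negPn/eqP.
apply: (anI _ _ _ xew); last exact: ideal_lbrl.
apply: Psi_an_shift => //; first by rewrite dformC.
by apply: weight_Psi xew xe0; apply: dualD => //; case: Pal.
Qed.

(** An ideal that centralizes the core is contained in it by (EA4), so it
    centralizes itself. *)
Lemma nonabelian_ideal_contains_core x y :
  I x -> I y -> lbr x y != 0 -> core `<=` I.
Proof.
move=> Ix Iy xy0; apply: contrapT => nCI.
have cI := ideal_centralizes_core nCI.
move: xy0; apply/negP/negPn/eqP; apply: (cI x Ix).
exact: (EA4 hE (cI y Iy)).
Qed.

End Ideal.

End EALATheory.

Theorem proposition3p4 (k : fieldType) (hk : [pchar k] =i pred0)
    (E : lieAlgType k) (H : submodClosed E) (form : {biscalar E})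
    (hE : is_EALA H form)
    (f : {linear E -> E}) (hf : lie_automorphism f) :
  f @` core H form = core H form.
Proof.
have [[g fK gK] fB] := hf.
have [C0 CD CB] := core_ideal hk hE.
have [x [y [Cx Cy xy0]]] := core_nonabelian hk hE.
have f_inj := can_inj fK.
apply/seteqP; split.
- suff CP : core H form `<=` f @^-1` core H form by move=> _ [z /CP Cz <-].
  apply: (nonabelian_ideal_contains_core hE _ (x := g x) (y := g y)).
  + split=> [|a u v Cu Cv|e u Cu] /=.
    * by rewrite linear0.
    * by rewrite linearP; apply: CD.
    * by rewrite fB; apply: CB.
  + by rewrite /= gK.
  + by rewrite /= gK.
  + by rewrite -(inj_eq f_inj) fB !gK linear0.
- apply: (nonabelian_ideal_contains_core hE _ (x := f x) (y := f y)).
  + split=> [|a _ _ [u Cu <-] [v Cv <-]|e _ [u Cu <-]].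
    * by exists 0 => //; rewrite linear0.
    * by exists (a *: u + v); [apply: CD|rewrite linearP].
    * by exists (lbr (g e) u); [apply: CB|rewrite fB gK].
  + by exists x.
  + by exists y.
  + by rewrite -fB -(linear0 f) (inj_eq f_inj).
Qed.
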